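(* Consider the deterministic $N$-player game described in the context under Assumption A. Suppose that $\|F(x)\|\le M_F$ for all $x\in X$ and some $M_F>0$, and that $\mathrm{VI}(X,F)$ satisfies the quasi sharpness property with coefficient $\beta>0$: $(x-x^* )^\top F(x)\ge\beta\,\mathrm{dist}(x,X^* )$ for all $x\in X$ and all $x^*\in X^*$. Suppose that $\frac{\beta}{M_F}\le\sqrt{\frac1{2-\lambda}}<1$ for some $\lambda\in(0,1)$. Let $\{x^k\}_{k=0}^\infty$ be generated by the synchronous gradient-response (SGR) scheme with geometrically decaying stepsizes $\gamma^k=\gamma^0q^k$, where $$\gamma^0>0,\qquad q=\sqrt{1-(1-\lambda)\frac{\beta^2}{M_F^2}}\in(0,1),$$ and with an initial point $x^0\in X$ satisfying $$\mathrm{dist}(x^0,X^* )\le D=\frac{\gamma^0M_F}{\frac{\beta}{M_F}-\sqrt{\frac{\beta^2}{M_F^2}-(1-q^2)}}.$$ Then for every $k\ge0$, $$\mathrm{dist}^2(x^k,X^* )\le\max\left\{\frac{(\gamma^0)^2M_F^4}{\beta^2},\ \mathrm{dist}^2(x^0,X^* )\right\}\left(1-(1-\lambda)\frac{\beta^2}{M_F^2}\right)^k.$$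
   Context: Deterministic game. Let $[N]=\{1,\dots,N\}$. Player $i\in[N]$ has strategy set $X_i\subseteq\mathbb R^{n_i}$; $X=\prod_{i=1}^NX_i$, $X_{-i}=\prod_{j\ne i}X_j$, $x_{-i}=(x_j)_{j\ne i}$. Given $x_{-i}\in X_{-i}$, player $i$ solves $\min_{x_i\in X_i}f_i(x_i,x_{-i})$ with $f_i$ real-valued (no randomness). Put $F(x)=(\nabla_{x_i}f_i(x_i,x_{-i}))_{i=1}^N$. $\mathrm{VI}(X,F)$: find $x^*\in X$ with $F(x^* )^\top(x-x^* )\ge0$ for all $x\in X$; its solution set is $X^*$ (the set of quasi-Nash equilibria). $\mathrm{dist}(x,A)=\inf_{y\in A}\|y-x\|$ and $\Pi$ denotes Euclidean projection. Assumption A (deterministic form). (A1) Each $X_i$ is convex and closed. (A2) For each $i$ and each $x_{-i}\in X_{-i}$, $f_i(\bullet,x_{-i})$ is $C^1$ on an open set $\mathcal O_i\supseteq X_i$. (A3) $X^*$ is closed and nonempty. SGR scheme. Given $x^0\in X$ and stepsizes $\{\gamma^k\}$, for each $k\ge0$: $x_i^{k+1}=\Pi_{X_i}[x_i^k-\gamma^k\nabla_{x_i}f_i(x_i^k,x_{-i}^k)]$ for all $i\in[N]$. *)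

(* Defs.v *)
From mathcomp Require Import all_boot all_order all_algebra.
From mathcomp Require Import all_classical all_reals all_analysis.

Set Implicit Arguments.
Unset Strict Implicit.
Unset Printing Implicit Defensive.

Import Order.TTheory GRing.Theory Num.Theory.
Import numFieldNormedType.Exports.

Local Open Scope classical_set_scope.
Local Open Scope ring_scope.

Section euclidean.
Context {R : realType} {m : nat}.
Implicit Types (A : set 'rV[R]_m) (u v y p : 'rV[R]_m) (g : 'rV[R]_m -> R).

Definition dotv u v : R := \sum_(j < m) u 0 j * v 0 j.

(* The library norm [`|u|] on row vectors is the sup norm. *)
Definition norm2 u : R := Num.sqrt (dotv u u).

(* Unspecified when [A] has no point nearest to [y]. *)
Definition eproj A y : 'rV[R]_m :=
  [get p | A p /\ forall z, A z -> norm2 (p - y) <= norm2 (z - y)].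

Definition gradient g y : 'rV[R]_m := \row_(j < m) 'D_(delta_mx 0 j) g y.

Definition C1_on (U : set 'rV[R]_m) g : Prop :=
  forall y, U y -> differentiable g y /\ {for y, continuous (gradient g)}.

End euclidean.

Section game.
Context {R : realType} {N : nat} {n : 'I_N -> nat}.

Definition profile : Type := forall i : 'I_N, 'rV[R]_(n i).

Implicit Types (X : forall i, set 'rV[R]_(n i)) (f : 'I_N -> profile -> R).
Implicit Types (x u v : profile).

Definition subp u v : profile := fun i => u i - v i.

Definition dotp u v : R := \sum_(i < N) dotv (u i) (v i).

Definition normp u : R := Num.sqrt (dotp u u).

Definition dist x (A : set profile) : R :=
  inf [set normp (subp y x) | y in A].

Definition feasible X : set profile := [set x | forall i, X i (x i)].

(* [dfwith x y] is [x] with its [i]-th component replaced by [y : 'rV_(n i)]: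
   this is f_i(., x_{-i}), and it does not depend on [x i]. *)
Definition cost f i x : 'rV[R]_(n i) -> R :=
  fun y => f i (@dfwith _ (fun j => 'rV[R]_(n j)) x i y).

Definition F f x : profile := fun i => gradient (cost f x) (x i).

Definition VI_sol X (G : profile -> profile) : set profile :=
  [set xs | feasible X xs /\
    forall x, feasible X x -> 0 <= dotp (G xs) (subp x xs)].

(* The product topology is the Euclidean one, since there are finitely many
   factors. *)
Definition assumption_A X f : Prop :=
  [/\ forall i, convex_set (X i) /\ closed (X i),
      forall i, exists U : set 'rV[R]_(n i),
        [/\ open U, X i `<=` U &
            forall x, (forall j, j != i -> X j (x j)) -> C1_on U (cost f x)]
    & closed (VI_sol X (F f) : set (prod_topology (fun i => 'rV[R]_(n i))))
      /\ VI_sol X (F f) !=set0].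

Definition quasi_sharp X (G : profile -> profile) (beta : R) : Prop :=
  forall x xs, feasible X x -> VI_sol X G xs ->
    beta * dist x (VI_sol X G) <= dotp (subp x xs) (G x).

Definition SGR X f (gamma : nat -> R) (x : nat -> profile) : Prop :=
  feasible X (x 0%N) /\
  forall k i, x k.+1 i = eproj (X i) (x k i - gamma k *: F f (x k) i).

End game.

Arguments profile R {N} n.

(* Main.v *)
Require Import Defs.
From mathcomp Require Import all_boot all_order all_algebra.
From mathcomp Require Import all_classical all_reals all_analysis.
From mathcomp Require Import ring lra.

(** Write [S] for the solution set, [d_k] for the distance of [x^k] to [S], and
    put [a = beta / M_F], [b = gamma0 * M_F], [r = sqrt lambda].

    Projecting onto [X i] does not increase the distance to a point of [X i]
    ([eproj_contract]), so, comparing [x^(k+1)] with any [y] in [S] and expanding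
    the square of one gradient step, quasi sharpness and the bound on [F] give
      [|x^(k+1) - y|^2 <= |x^k - y|^2 - 2 gamma_k beta d_k + gamma_k^2 M_F^2].
    The last two terms do not depend on [y], so taking the infimum over [y] turns
    this into a recurrence on [d_k^2] ([projected_step_dist]).

    With [C = max (b / a) d_0], the bound [d_k <= C q^k] then propagates
    ([geometric_step]). After division by [q^(2k)] the right-hand side is
    [s^2 - 2 a b s + b^2] with [s = d_k / q^k] in [[0, C]]. It is convex in [s],
    so it suffices to compare it with [q^2 C^2] at both ends. At [s = 0] this
    follows from [b <= a C] and from [a^2 <= q^2], which is the ratio
    condition in the form [a^2 (2 - lambda) <= 1]. At [s = C]
    it says that the quadratic [(1 - r^2) (a C)^2 - 2 b (a C) + b^2] is
    nonpositive, i.e. that [a C] lies between its roots [b / (1 + r)] and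
    [b / (1 - r)]; the upper root is exactly the requirement [C <= D], because
    [D = b / (a (1 - r))]. *)

Import Order.TTheory GRing.Theory Num.Theory.
Import numFieldNormedType.Exports.

Local Open Scope classical_set_scope.
Local Open Scope ring_scope.

(** * Euclidean geometry of row vectors *)

Lemma dotv_ge0 (R : realType) (m : nat) (u : 'rV[R]_m) : 0 <= dotv u u.
Proof. by apply: sumr_ge0 => j _; rewrite -expr2 sqr_ge0. Qed.

Lemma dotvC (R : realType) (m : nat) (u v : 'rV[R]_m) : dotv u v = dotv v u.
Proof. by apply: eq_bigr => j _; rewrite mulrC. Qed.

Lemma dotvZr (R : realType) (m : nat) (u v : 'rV[R]_m) (t : R) :
  dotv u (t *: v) = t * dotv u v.
Proof.
by rewrite /dotv mulr_sumr; apply: eq_bigr => j _; rewrite !mxE; ring.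
Qed.

Lemma dotvD_sqr (R : realType) (m : nat) (u v : 'rV[R]_m) :
  dotv (u + v) (u + v) = dotv u u + 2 * dotv u v + dotv v v.
Proof.
rewrite /dotv mulr_sumr -!big_split; apply: eq_bigr => j _.
by rewrite !mxE /=; ring.
Qed.

(** Transfers Euclidean boundedness to the sup norm, in which compactness of
    closed bounded sets of row vectors is stated. *)
Lemma sup_norm_le_norm2 (R : realType) (m : nat) (u : 'rV[R]_m) :
  `|u| <= norm2 u.
Proof.
rewrite [leLHS]mx_normrE; apply: bigmax_le => [|[i j] _ /=].
  exact: sqrtr_ge0.
rewrite ord1 -sqrtr_sqr ler_wsqrtr// /dotv (bigD1 j)//= expr2 lerDl.
by apply: sumr_ge0 => k _; rewrite -expr2 sqr_ge0.
Qed.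

Lemma norm2_sub_continuous (R : realType) (m : nat) (y : 'rV[R]_m) :
  continuous (fun z : 'rV[R]_m => norm2 (z - y)).
Proof.
move=> z; have nbhsF : Filter (nbhs (z : 'rV[R]_m)) := nbhs_filter _.
suff cdot : {for z, continuous (fun w : 'rV[R]_m => dotv (w - y) (w - y))}.
  exact: (continuous_comp cdot (@sqrt_continuous R _)).
apply: cvg_big => [|j _]; first exact: add_continuous.
have hj : (fun w : 'rV[R]_m => (w - y) 0 j) @ z --> (z - y) 0 j.
  under eq_fun do rewrite !mxE.
  by rewrite !mxE; apply: cvgB; [exact: coord_continuous | exact: cvg_cst].
exact: cvgM.
Qed.

(** * Projection onto a closed convex set *)

(** Points of [A] farther from [y] than a fixed [z0] in [A] are irrelevant, so
    the minimum may be sought on the compact part of [A] within that distance. *)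
Lemma nearest_point_exists (R : realType) (m : nat) (A : set 'rV[R]_m)
    (y : 'rV[R]_m) :
  closed A -> A !=set0 ->
  exists p, A p /\ forall z, A z -> norm2 (p - y) <= norm2 (z - y).
Proof.
move=> Acl [z0 Az0].
set r := norm2 (z0 - y).
pose K := A `&` [set z | norm2 (z - y) <= r].
have Kcl : closed K.
  apply: closedI => //.
  refine (@preimage_closed _ R^o (fun z : 'rV[R]_m => norm2 (z - y))
    [set s | s <= r] _ _).
    by move=> z _; exact: norm2_sub_continuous.
  exact: closed_le.
have Kbd : bounded_set K.
  exists (r + `|y|); split; first exact: num_real.
  move=> M ltM z [_ /= zr] /=; apply: le_trans (ltW ltM).
  rewrite -[leLHS]/(`|z : 'rV[R]_m|) -{1}(subrK y z).
  apply: le_trans (ler_normD _ _) _; rewrite lerD2r.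
  by apply: le_trans zr; exact: (@sup_norm_le_norm2 R m (z - y)).
have Kz0 : K z0 by split => /=.
have [p] := EVT_min_rV (ex_intro _ z0 Kz0) (bounded_closed_compact Kbd Kcl)
  (continuous_subspaceT (@norm2_sub_continuous R m y)).
rewrite inE => -[Ap pr] pmin; exists p; split => // z Az.
have [zr|/ltW rz] := leP (norm2 (z - y)) r; last exact: le_trans pr rz.
by apply: pmin; rewrite inE.
Qed.

Lemma eproj_nearest (R : realType) (m : nat) (A : set 'rV[R]_m)
    (y : 'rV[R]_m) :
  closed A -> A !=set0 ->
  A (eproj A y) /\ forall z, A z -> norm2 (eproj A y - y) <= norm2 (z - y).
Proof.
move=> Acl A0.
exact: (@getPex _ (fun p => A p /\ forall z, A z -> _)
  (nearest_point_exists _ _ _ y Acl A0)).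
Qed.

(** Convexity restated along the segment that leaves [p] in direction [z - p],
    the form in which the optimality of [p] is differentiated. *)
Lemma segment_convex (R : realType) (m : nat) (A : set 'rV[R]_m) p z (t : R) :
  convex_set A -> A p -> A z -> 0 <= t <= 1 -> A (p + t *: (z - p)).
Proof.
move=> Acv Ap Az /andP[t0 t1].
have tI : Itv.spec (@Itv.num_sem R) (Itv.Real `[0%Z, 1%Z]) t.
  by rewrite /Itv.spec /= /Itv.num_sem /= num_real in_itv/= t0 t1.
have -> : p + t *: (z - p) = t *: z + (1 - t) *: p.
  by apply/rowP => j; rewrite !mxE; ring.
by have := Acv z p (Itv.mk tI); rewrite !inE; apply.
Qed.

(** First-order optimality: moving from the projection a small amount [t]
    towards [z] changes half the squared distance to [y] at a rate equal to
    this inner product, which cannot be negative at a minimiser. *)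
Lemma eproj_obtuse (R : realType) (m : nat) (A : set 'rV[R]_m)
    (y z : 'rV[R]_m) :
  closed A -> convex_set A -> A z ->
  0 <= dotv (eproj A y - y) (z - eproj A y).
Proof.
move=> Acl Acv Az.
have [Ap pmin] := @eproj_nearest R m A y Acl (ex_intro _ z Az).
move: (eproj A y) Ap pmin => p Ap pmin.
set c := dotv _ _; set s := dotv (z - p) (z - p).
have s0 : 0 <= s := dotv_ge0 _ _ _.
have seg (t : R) : 0 <= t <= 1 -> 0 <= t * (2 * c + t * s).
  move=> t01; have := pmin _ (@segment_convex _ _ _ _ _ _ Acv Ap Az t01).
  rewrite ler_sqrt ?dotv_ge0// addrAC (dotvD_sqr _ _ (p - y)).
  rewrite dotvZr (_ : dotv (t *: _) _ = t ^+ 2 * s); last first.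
    by rewrite /s /dotv mulr_sumr; apply: eq_bigr => j _; rewrite !mxE; ring.
  by rewrite -/c; nra.
(* If [c < 0], the step [t = - c / (s - c)] is admissible, and it is short
   enough that [2 * c + t * s <= c < 0]. *)
rewrite leNgt; apply/negP => c0.
have d0 : 0 < s - c by lra.
have t0 : 0 < - c / (s - c) by rewrite divr_gt0//; lra.
have t1 : - c / (s - c) <= 1 by rewrite ler_pdivrMr//; lra.
have ts : - c / (s - c) * s <= - c.
  by rewrite mulrAC ler_pdivrMr//; nra.
have := seg _ (introT andP (conj (ltW t0) t1)).
rewrite pmulr_rge0//; move: ts; set ts := _ * s => tsc ?; lra.
Qed.

(** In the triangle with vertices [y], its projection and [z], the angle at
    the projection is at least a right angle, so the side facing it is the
    longest. *)
Lemma eproj_contract (R : realType) (m : nat) (A : set 'rV[R]_m)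
    (y z : 'rV[R]_m) :
  closed A -> convex_set A -> A z ->
  dotv (z - eproj A y) (z - eproj A y) <= dotv (z - y) (z - y).
Proof.
move=> Acl Acv Az; have := @eproj_obtuse R m A y z Acl Acv Az.
set p := eproj A y => h.
rewrite -[X in _ <= dotv X X](subrKA p) (dotvD_sqr _ _ (z - p)).
rewrite (dotvC _ _ (z - p)).
by have := dotv_ge0 _ _ (p - y); lra.
Qed.

(** * Distance to a set of profiles *)

Lemma dist_ge0 (R : realType) (N : nat) (n : 'I_N -> nat) (u : profile R n) A :
  A !=set0 -> 0 <= dist u A.
Proof.
move=> [y Ay]; apply: lb_le_inf; first by exists (normp (subp y u)), y.
by move=> _ [w _ <-]; exact: sqrtr_ge0.
Qed.

Lemma dotp_ge0 (R : realType) (N : nat) (n : 'I_N -> nat) (u : profile R n) :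
  0 <= dotp u u.
Proof. by apply: sumr_ge0 => i _; exact: dotv_ge0. Qed.

(** The constant [c] is the same for all [y], which is why a pointwise
    comparison of squared distances survives the infimum. *)
Lemma dist_sqr_le (R : realType) (N : nat) (n : 'I_N -> nat)
    (u v : profile R n) A (c : R) : A !=set0 ->
  (forall y, A y ->
    dotp (subp y u) (subp y u) <= dotp (subp y v) (subp y v) + c) ->
  dist u A ^+ 2 <= dist v A ^+ 2 + c.
Proof.
move=> A0 le_uv.
have lb0 : has_lbound [set normp (subp y u) | y in A].
  by exists 0 => _ [w _ <-]; exact: sqrtr_ge0.
(* A nonpositive [a] is below any square; otherwise [sqrt a] is a lower bound
   of the distances from [v]. *)
rewrite -lerBlDr; set a := _ - c.
have [a0|/ltW a0] := leP a 0; first exact: le_trans a0 (sqr_ge0 _).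
rewrite -[a]sqr_sqrtr// lerXn2r ?nnegrE ?sqrtr_ge0 ?dist_ge0//.
apply: lb_le_inf; first by case: A0 => y Ay; exists (normp (subp y v)), y.
move=> _ [y Ay <-]; apply: ler_wsqrtr; rewrite /a lerBlDr.
apply: le_trans (le_uv y Ay).
rewrite -[leRHS]sqr_sqrtr ?dotp_ge0// lerXn2r ?nnegrE ?sqrtr_ge0 ?dist_ge0//.
by apply: ge_inf => //; exists y.
Qed.

(** The recurrence behind the convergence. The set [S] may be any set of
    feasible profiles towards which the direction [G] at [x] is sharp: only
    [dotp (subp x xs) G >= beta * dist x S] links the two. *)
Lemma projected_step_dist (R : realType) (N : nat) (n : 'I_N -> nat)
    (X : forall i, set 'rV[R]_(n i)) (S : set (profile R n))
    (x x' G : profile R n) (g beta M : R) :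
  (forall i, convex_set (X i) /\ closed (X i)) ->
  S !=set0 -> S `<=` feasible X ->
  0 <= g -> normp G <= M ->
  (forall xs, S xs -> beta * dist x S <= dotp (subp x xs) G) ->
  (forall i, x' i = eproj (X i) (x i - g *: G i)) ->
  dist x' S ^+ 2 <=
    dist x S ^+ 2 + (g ^+ 2 * M ^+ 2 - 2 * g * (beta * dist x S)).
Proof.
move=> hX S0 SX g0 GM sharp stepE; apply: dist_sqr_le => // y Sy.
have GM2 : dotp G G <= M ^+ 2.
  rewrite -[leLHS]sqr_sqrtr ?dotp_ge0// lerXn2r ?nnegrE ?sqrtr_ge0//.
  exact: le_trans (sqrtr_ge0 _) GM.
suff : dotp (subp y x') (subp y x') <=
    dotp (subp y x) (subp y x) - 2 * g * dotp (subp x y) G + g ^+ 2 * dotp G G.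
  by have := sharp y Sy; have := sqr_ge0 g; nra.
rewrite /dotp !mulr_sumr -sumrN -!big_split; apply: ler_sum => i _ /=.
have [Xcv Xcl] := hX i.
rewrite /subp stepE.
apply: le_trans (@eproj_contract _ _ _ _ _ Xcl Xcv (SX y Sy i)) _.
rewrite le_eqVlt; apply/orP; left; apply/eqP.
rewrite /dotv !mulr_sumr -sumrN -!big_split; apply: eq_bigr => j _ /=.
by rewrite !mxE; ring.
Qed.

(** * Geometric decay *)

(** The statement is homogeneous in [(b, s, c)], so it applies at stage [k] to
    quantities that all carry the factor [q ^+ k]. *)
Lemma geometric_step (R : realType) (a r b s c : R) :
  0 < a -> 0 <= r -> a ^+ 2 * (2 - r ^+ 2) <= 1 ->
  0 <= b -> b <= a * c -> a * (1 - r) * c <= b -> 0 <= s <= c ->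
  s ^+ 2 - 2 * a * b * s + b ^+ 2 <= (1 - (1 - r ^+ 2) * a ^+ 2) * c ^+ 2.
Proof.
move=> a0 r0 ha b0 bc cb /andP[s0 sc].
set Q := leRHS.
have c0 : 0 <= c by exact: le_trans sc.
have end0 : b ^+ 2 <= Q.
  have : b ^+ 2 <= (a * c) ^+ 2 by rewrite lerXn2r ?nnegrE// mulr_ge0// ltW.
  by rewrite /Q; have := sqr_ge0 c; nra.
have endc : c ^+ 2 - 2 * a * b * c + b ^+ 2 <= Q.
  (* The factors place [a * c] between the two roots of the quadratic. *)
  rewrite -subr_ge0.
  rewrite (_ : _ - _ = (b - a * (1 - r) * c) * (a * (1 + r) * c - b)); last first.
    by rewrite /Q; ring.
  rewrite mulr_ge0// subr_ge0//; apply: le_trans bc _.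
  by rewrite ler_wpM2r// ler_pMr// lerDl.
(* Convexity in [s]: [c] times the left-hand side is at most the combination
   of its values at [0] and [c] with weights [c - s] and [s], the gap
   being [c * (s * (c - s))]. *)
have [c00|cn0] := eqVneq c 0.
  have -> : s = 0 by lra.
  by lra.
have cp : 0 < c by rewrite lt_neqAle eq_sym cn0.
rewrite -(ler_pM2l cp).
have h1 : (c - s) * b ^+ 2 <= (c - s) * Q by rewrite ler_wpM2l// subr_ge0.
have h2 : s * (c ^+ 2 - 2 * a * b * c + b ^+ 2) <= s * Q by rewrite ler_wpM2l.
have h3 : 0 <= c * (s * (c - s)) by rewrite !mulr_ge0// subr_ge0.
by lra.
Qed.

(** * Convergence of the gradient-response scheme *)

Theorem theorem3p8 (R : realType) (N : nat) (n : 'I_N -> nat)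
  (X : forall i : 'I_N, set 'rV[R]_(n i)) (f : 'I_N -> profile R n -> R)
  (M_F beta lambda gamma0 q D : R) (x : nat -> profile R n)
  (hA : assumption_A X f)
  (hM_F : 0 < M_F)
  (hF : forall y, feasible X y -> normp (F f y) <= M_F)
  (hbeta : 0 < beta)
  (hsharp : quasi_sharp X (F f) beta)
  (hlambda : 0 < lambda < 1)
  (hratio : beta / M_F <= Num.sqrt (1 / (2 - lambda)))
  (hsqrt : Num.sqrt (1 / (2 - lambda)) < 1)
  (hgamma0 : 0 < gamma0)
  (hq : q = Num.sqrt (1 - (1 - lambda) * (beta ^+ 2 / M_F ^+ 2)))
  (hD : D = gamma0 * M_F /
     (beta / M_F - Num.sqrt (beta ^+ 2 / M_F ^+ 2 - (1 - q ^+ 2))))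
  (hx : SGR X f (fun k => gamma0 * q ^+ k) x)
  (hx0 : dist (x 0%N) (VI_sol X (F f)) <= D) :
  forall k : nat,
    dist (x k) (VI_sol X (F f)) ^+ 2 <=
      Num.max (gamma0 ^+ 2 * M_F ^+ 4 / beta ^+ 2)
              (dist (x 0%N) (VI_sol X (F f)) ^+ 2)
      * (1 - (1 - lambda) * (beta ^+ 2 / M_F ^+ 2)) ^+ k.
Proof.
have [hX _ [_ S0]] := hA.
have [x0X stepE] := hx.
set S := VI_sol X (F f) in S0 hx0 *.
have SX : S `<=` feasible X by move=> y [].
have feas k : feasible X (x k).
  case: k => [|k]// i; rewrite stepE.
  by have [] := @eproj_nearest _ _ (X i)
    (x k i - gamma0 * q ^+ k *: F f (x k) i) (hX i).2 (ex_intro _ _ (x0X i)).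
have /andP[l0 l1] := hlambda.
rewrite -expr_div_n in hq hD *.
set a := beta / M_F in hratio hq hD *.
have a0 : 0 < a by rewrite divr_gt0.
have betaE : beta = a * M_F by rewrite /a divfK// gt_eqF.
clearbody a.
set r := Num.sqrt lambda.
have r0 : 0 <= r := sqrtr_ge0 _.
have rE : r ^+ 2 = lambda by rewrite sqr_sqrtr// ltW.
have r1 : r < 1 by nra.
have ha : a ^+ 2 * (2 - lambda) <= 1.
  have : a ^+ 2 <= 1 / (2 - lambda).
    rewrite -[leRHS]sqr_sqrtr; last by rewrite divr_ge0//; lra.
    by rewrite lerXn2r ?nnegrE ?sqrtr_ge0// ltW.
  by rewrite ler_pdivlMr//; lra.
have q2 : q ^+ 2 = 1 - (1 - lambda) * a ^+ 2.
  by rewrite hq sqr_sqrtr//; nra.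
have q0 : 0 <= q by rewrite hq sqrtr_ge0.
set b := gamma0 * M_F.
have b0 : 0 < b by rewrite mulr_gt0.
have DE : D = b / (a * (1 - r)).
  (* [1 - q ^+ 2 = (1 - r ^+ 2) * a ^+ 2], so the radicand is a square. *)
  rewrite hD q2 (_ : a ^+ 2 - _ = (a * r) ^+ 2); last by rewrite exprMn rE; ring.
  by rewrite sqrtr_sqr ger0_norm ?mulr_ge0 ?(ltW a0)// mulrBr mulr1.
set C := Num.max (b / a) (dist (x 0%N) S).
have CE : Num.max (gamma0 ^+ 2 * M_F ^+ 4 / beta ^+ 2) (dist (x 0%N) S ^+ 2)
    = C ^+ 2.
  have ba0 : 0 <= b / a by rewrite divr_ge0 ?ltW.
  have -> : gamma0 ^+ 2 * M_F ^+ 4 / beta ^+ 2 = (b / a) ^+ 2.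
    rewrite /b betaE; field.
    by rewrite ?gt_eqF.
  have d0 := @dist_ge0 _ _ _ (x 0%N) S S0.
  rewrite /C; have [h|h] := leP (b / a) (dist (x 0%N) S).
    by apply: max_r; rewrite lerXn2r ?nnegrE.
  by apply: max_l; rewrite lerXn2r ?nnegrE// ltW.
have bC : b <= a * C by rewrite mulrC -ler_pdivrMr// le_max lexx.
(* This is [C <= D]: [d_0 <= D] is assumed, and [b / a <= D] as [1 - r <= 1]. *)
have Cb : a * (1 - r) * C <= b.
  have ar0 : 0 < a * (1 - r) by rewrite mulr_gt0// subr_gt0.
  rewrite mulrC -ler_pdivlMr// ge_max -DE hx0 andbT DE.
  rewrite ler_pM2l// lef_pV2 ?posrE// ler_piMr ?(ltW a0)//; lra.
have C0 : 0 <= C by rewrite le_max dist_ge0// orbT.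
rewrite CE -q2.
elim=> [|k IH].
  by rewrite expr0 mulr1 lerXn2r ?nnegrE ?dist_ge0// le_max lexx orbT.
have qk0 : 0 <= q ^+ k by exact: exprn_ge0.
set d := dist (x k) S in IH.
have dC : d <= C * q ^+ k.
  rewrite -(@ler_pXn2r _ 2) ?nnegrE ?dist_ge0 ?mulr_ge0//.
  by rewrite exprMn -exprM mulnC exprM.
have step := @projected_step_dist _ _ _ X S (x k) (x k.+1) (F f (x k))
  (gamma0 * q ^+ k) beta M_F hX S0 SX (mulr_ge0 (ltW hgamma0) qk0)
  (hF _ (feas k)) (fun xs => hsharp _ _ (feas k)) (stepE k).
apply: le_trans step _; rewrite -/d.
have -> : C ^+ 2 * q ^+ 2 ^+ k.+1 =
    (1 - (1 - r ^+ 2) * a ^+ 2) * (C * q ^+ k) ^+ 2.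
  by rewrite rE -q2 (exprS (q ^+ 2)) (exprAC q 2 k); ring.
have bq0 : 0 <= b * q ^+ k by rewrite mulr_ge0// ltW.
have bCq : b * q ^+ k <= a * (C * q ^+ k) by rewrite mulrA ler_wpM2r.
have Cbq : a * (1 - r) * (C * q ^+ k) <= b * q ^+ k by rewrite mulrA ler_wpM2r.
have d0C : 0 <= d <= C * q ^+ k by rewrite dist_ge0.
have har : a ^+ 2 * (2 - r ^+ 2) <= 1 by rewrite rE.
apply: le_trans (@geometric_step _ _ _ _ _ _ a0 r0 har bq0 bCq Cbq d0C).
by rewrite betaE /b le_eqVlt; apply/orP; left; apply/eqP; ring.
Qed.
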